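(* Consider the iterative procedure DR-RC-Iterative-MPC (defined in the context), initialized with a sampled-safe-set $\mathcal{S}^0$ that contains the states of a finite-length robustly safe trajectory from $x_S$ to $x_F$ (initialization assumption in the context). Then, at each iteration $j\ge 1$ and time-step $t\ge 0$, the finite-horizon problem $\mathrm{FH}(x;\overline{\mathcal{S}},\overline{\mathcal{D}})$ with $x=x_t^j$, $\overline{\mathcal{S}}=\mathcal{S}^{j-1}$ and $\overline{\mathcal{D}}=\mathcal{D}^{j-1}$ that is solved in the procedure is feasible. Further, the generated trajectory $(\mathsf{x}^j,\mathsf{u}^j)$ is $(\zeta,\mathbb{P}^{|\widehat{\mathcal{W}}^{j-1}|})$-safe, that is, $$\mathbb{P}^{|\widehat{\mathcal{W}}^{j-1}|}\Bigl(\mathrm{CVaR}_\beta^{\mathbb{P}}[g(x_t^j,w)]\le\delta\Bigr)\ge\zeta\qquad\text{for all } t\in\{0,1,\dots,T_j\}.$$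
   Context: Notation: $\mathbb{N}=\{0,1,2,\dots\}$, $[z]_+=\max(z,0)$. For a random variable $Z$ with distribution $\mu$ and $\beta\in(0,1)$, $\mathrm{CVaR}_\beta^{\mu}[Z]=\inf_{s\in\mathbb{R}}\{s+\beta^{-1}\mathbb{E}^{\mu}[Z-s]_+\}$. Problem data. The system is $x_{t+1}=f(x_t,u_t)$ with $f:\mathbb{R}^{n_x}\times\mathbb{R}^{n_u}\to\mathbb{R}^{n_x}$; states and inputs are constrained to compact sets $\mathcal{X}\subset\mathbb{R}^{n_x}$, $\mathcal{U}\subset\mathbb{R}^{n_u}$. $x_S\in\mathcal{X}$ is the initial state and $x_F\in\mathcal{X}$ the target equilibrium, i.e. $0\in\mathcal{U}$ and $f(x_F,0)=x_F$. The stage cost $r:\mathcal{X}\times\mathcal{U}\to[0,\infty)$ is continuous, $r(x_F,0)=0$ and $r(x,u)>0$ for $(x,u)\ne(x_F,0)$. $w$ is a random variable with (unknown) distribution $\mathbb{P}$ supported on a compact set $\mathcal{W}\subset\mathbb{R}^{n_w}$; $g:\mathcal{X}\times\mathcal{W}\to\mathbb{R}$ is continuous; $\delta>0$, $\beta\in(0,1)$, $\zeta\in(0,1)$ and the horizon $K\in\mathbb{N}$, $K\ge1$, are given. Ambiguity sets. $\mathbb{D}$ is a map assigning to each finite dataset of samples from $\mathcal{W}$ a closed nonempty set of probability distributions supported on $\mathcal{W}$. With $\widehat{\mathcal{W}}^{j}$ the dataset of i.i.d. samples of $w$ available at the end of iteration $j$ (with $\widehat{\mathcal{W}}^{0}$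 given initially, and one sample per time-step added during each iteration), set $\mathcal{D}^{j}=\mathbb{D}(\widehat{\mathcal{W}}^{j})$. It is assumed that these sets are reliable: $\mathbb{P}^{|\widehat{\mathcal{W}}^{j}|}(\mathbb{P}\in\mathcal{D}^{j})\ge\zeta$ for all $j\ge0$. Sampled-safe-sets. A sampled-safe-set is a finite set $\mathcal{S}\subset\mathbb{N}\times\mathcal{X}\times[0,\infty)$ of triples (trajectory index $i$, state $x$, cost-to-go $J$). $\Pi_{\mathrm{state}}(\mathcal{S})$ is the set of states appearing in it. Its minimum cost-to-go is $Q_{\mathcal{S}}(x)=\min\{J:(i,x,J)\in\mathcal{S}\}$ for $x\in\Pi_{\mathrm{state}}(\mathcal{S})$, and $+\infty$ otherwise. Finite-horizon problem. For a state $x$, sampled-safe-set $\overline{\mathcal{S}}$ and ambiguity set $\overline{\mathcal{D}}$, $\mathrm{FH}(x;\overline{\mathcal{S}},\overline{\mathcal{D}})$ is: minimize $\sum_{k=0}^{K-1}r(x_k,u_k)+Q_{\overline{\mathcal{S}}}(x_K)$ over $(x_0,\dots,x_K)$, $(u_0,\dots,u_{K-1})$ subject to $x_0=x$; $x_{k+1}=f(x_k,u_k)$, $x_k\in\mathcal{X}$, $u_k\in\mathcal{U}$, $\sup_{\mu\in\overline{\mathcal{D}}}\mathrm{CVaR}_\beta^{\mu}[g(x_k,w)]\le\delta$ for all $k=0,\dots,K-1$; and $x_K\in\Pi_{\mathrm{state}}(\overline{\mathcal{S}})$. Whenever it is feasible, the minimum is taken to be attained. Routine $\mathrm{DR\_MPC}(\overline{\mathcal{S}},\overline{\mathcal{D}})$: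 start with $t=0$, $x_0=x_S$. While $x_t\ne x_F$: solve $\mathrm{FH}(x_t;\overline{\mathcal{S}},\overline{\mathcal{D}})$, let $u_t$ be the first input of an optimizer, set $x_{t+1}=f(x_t,u_t)$, and increase $t$ by one. Return the state and input sequences. DR-RC-Iterative-MPC: for $j=1,2,\dots$: (1) $(\mathsf{x}^j,\mathsf{u}^j)=\mathrm{DR\_MPC}(\mathcal{S}^{j-1},\mathcal{D}^{j-1})$, with $\mathsf{x}^j=[x_0^j,\dots,x_{T_j}^j]$, $\mathsf{u}^j=[u_0^j,\dots,u_{T_j-1}^j]$; $T_j$ is its length; (2) $\widehat{\mathcal{W}}^{j}$ is $\widehat{\mathcal{W}}^{j-1}$ with the $T_j$ new samples added, $\mathcal{D}^j=\mathbb{D}(\widehat{\mathcal{W}}^j)$; (3) form $\tilde{\mathcal{S}}=\mathcal{S}^{j-1}\cup\{(j,x_t^j,J^j_{(t:\infty)})\}_{t=1}^{T_j}$, where $J^j_{(t:\infty)}=\sum_{k=t}^{\infty}r(x_k^j,u_k^j)$ and the state stays at $x_F$ with zero input for times $\ge T_j$; (4) $\mathcal{S}^j$ is obtained from $\tilde{\mathcal{S}}$ by deleting all triples of every trajectory index $i$ for which some $(i,x,J)\in\tilde{\mathcal{S}}$ has $\sup_{\mu\in\mathcal{D}^j}\mathrm{CVaR}_\beta^{\mu}[g(x,w)]>\delta$. Standing assumption: the trajectories are of finite length $T_j\ge1$. Initialization assumption: $\mathcal{S}^0$ consists of the triples (index $0$, state, cost-to-go) for the states of a finite-length trajectory $\mathsf{x}^0=[x_0^0,\dots,x_{T_0}^0]$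 of the system, generated by inputs in $\mathcal{U}$, that starts at $x_S$ and reaches $x_F$, and is robustly safe: $x\in\mathcal{X}$ and $g(x,w)\le\delta$ for all $w\in\mathcal{W}$ and all $x\in\Pi_{\mathrm{state}}(\mathcal{S}^0)$. *)

(* Defs.v *)
From HB Require Import structures.
From mathcomp Require Export all_boot all_order all_algebra finmap.
From mathcomp Require Export all_classical all_reals all_analysis.
Export Order.TTheory GRing.Theory Num.Theory numFieldNormedType.Exports.

#[export] Set Implicit Arguments.
#[export] Unset Strict Implicit.
#[export] Unset Printing Implicit Defensive.

Local Open Scope classical_set_scope.
Local Open Scope ring_scope.

(* R^n with its Borel sigma-algebra *)
Notation borel_vec R n := (g_sigma_algebraType (@open 'rV[R]_n)).

Section Probability.
Context {R : realType}.

(* P(A) >= z for an event that need not be measurable: the bound holds for the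
   inner probability of A.  For a measurable A it says z <= P A, see
   [prob_geE]. *)
Definition prob_ge d (T : measurableType d) (P : probability T R)
    (A : set T) (z : R) : Prop :=
  exists B : set T, [/\ measurable B, B `<=` A & (z%:E <= P B)%E].

Lemma prob_geE d (T : measurableType d) (P : probability T R) (A : set T)
    (z : R) : measurable A -> prob_ge P A z <-> (z%:E <= P A)%E.
Proof.
move=> mA; split=> [[B [mB BA zB]]|zA]; last by exists A; split.
apply: (le_trans zB); apply: (le_measure P _ _ BA); exact: mem_set.
Qed.

(* The random variable Z only has to make sense on a set A with mu A = 1,
   hence the domain of integration. *)
Definition CVaR d (T : measurableType d) (beta : R) (mu : probability T R)
    (A : set T) (Z : T -> R) : \bar R :=
  ereal_inf [set (s%:E + (beta^-1)%:E *
                  \int[mu]_(w in A) (Num.max (Z w - s) 0)%:E)%E | s in setT].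

(* Closedness for weak convergence.  That topology is metrizable on the
   probability distributions on R^n, so sequences suffice. *)
Definition weakly_closed n (D : set (probability (borel_vec R n) R)) : Prop :=
  forall (nu : nat -> probability (borel_vec R n) R)
         (mu : probability (borel_vec R n) R),
    (forall k, D (nu k)) ->
    (forall phi : 'rV[R]_n -> R, continuous phi ->
       (exists M : R, forall w, `|phi w| <= M) ->
       (\int[nu k]_w (phi w)%:E)%E @[k --> \oo] --> (\int[mu]_w (phi w)%:E)%E) ->
    D mu.

(* Every finite prefix (w_0, ..., w_(n-1)) has law P^n, which is stated on
   measurable rectangles. *)
Definition iid_samples d (Om : measurableType d) (Pr : probability Om R) n
    (P : probability (borel_vec R n) R)
    (ws : nat -> {RV Pr >-> borel_vec R n}) : Prop :=
  forall (m : nat) (A : nat -> set (borel_vec R n)),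
    (forall k, measurable (A k)) ->
    Pr [set om | forall k, (k < m)%N -> A k (ws k om)]
      = (\prod_(k < m) P (A k))%E.

End Probability.

Record problem (R : realType) (nx nu nw : nat) := Problem {
  dyn : 'rV[R]_nx -> 'rV[R]_nu -> 'rV[R]_nx;
  Xset : set 'rV[R]_nx;
  Uset : set 'rV[R]_nu;
  Wset : set 'rV[R]_nw;
  x_S : 'rV[R]_nx;
  x_F : 'rV[R]_nx;
  cost : 'rV[R]_nx -> 'rV[R]_nu -> R;
  constr : 'rV[R]_nx -> 'rV[R]_nw -> R;
  delta : R;
  beta : R;
  horizon : nat;
  (* the map from finite datasets to ambiguity sets *)
  ambig : seq 'rV[R]_nw -> set (probability (borel_vec R nw) R)
}.

(* (trajectory index, state, cost-to-go) *)
Definition triple (R : realType) (nx : nat) : choiceType :=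
  (nat * 'rV[R]_nx * R)%type.
Definition tindex R nx (p : triple R nx) : nat := p.1.1.
Definition tstate R nx (p : triple R nx) : 'rV[R]_nx := p.1.2.
Definition tcost R nx (p : triple R nx) : R := p.2.

(* The trajectories x^j, u^j of length T_j for j >= 1; index 0 is unused. *)
Record execution (R : realType) (nx nu : nat) := Execution {
  ex_x : nat -> nat -> 'rV[R]_nx;
  ex_u : nat -> nat -> 'rV[R]_nu;
  ex_T : nat -> nat
}.

Section Problem.
Context {R : realType} {nx nu nw : nat}.
Variable pb : problem R nx nu nw.

Notation state := 'rV[R]_nx.
Notation input := 'rV[R]_nu.
Notation f := (dyn pb).
Notation X := (Xset pb).
Notation U := (Uset pb).
Notation W := (Wset pb).
Notation xS := (x_S pb).
Notation xF := (x_F pb).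
Notation r := (cost pb).
Notation g := (constr pb).
Notation K := (horizon pb).
Notation triple := (triple R nx).
Notation ambiguity_set := (set (probability (borel_vec R nw) R)).

Record problem_assumptions : Prop := ProblemAssumptions {
  X_compact : compact X;
  U_compact : compact U;
  W_compact : compact W;
  xS_in : X xS;
  xF_in : X xF;
  U0 : U 0;
  xF_equilibrium : f xF 0 = xF;
  cost_continuous : {within X `*` U, continuous (fun p => r p.1 p.2)};
  cost_ge0 : forall x u, X x -> U u -> 0 <= r x u;
  cost_xF : r xF 0 = 0;
  cost_gt0 : forall x u, X x -> U u -> (x, u) <> (xF, 0) -> 0 < r x u;
  constr_continuous : {within X `*` W, continuous (fun p => g p.1 p.2)};
  delta_gt0 : 0 < delta pb;
  beta_itv : 0 < beta pb < 1;
  horizon_ge1 : (1 <= K)%N;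
  ambig_nonempty : forall s : seq 'rV[R]_nw,
    (forall w, w \in s -> W w) -> ambig pb s !=set0;
  ambig_closed : forall s : seq 'rV[R]_nw,
    (forall w, w \in s -> W w) -> weakly_closed (ambig pb s);
  ambig_support : forall s : seq 'rV[R]_nw,
    (forall w, w \in s -> W w) -> forall mu, ambig pb s mu -> mu W = 1%E
}.

Definition risk (mu : probability (borel_vec R nw) R) (x : state) : \bar R :=
  CVaR (beta pb) mu W (g x).

Definition worst_risk (D : ambiguity_set) (x : state) : \bar R :=
  ereal_sup [set risk mu x | mu in D].

Definition sampled_safe_set (S : {fset triple}) : Prop :=
  forall p, p \in S -> X (tstate p) /\ 0 <= tcost p.

Definition Pi_state (S : {fset triple}) : set state :=
  [set x | exists2 p, p \in S & tstate p = x].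

Definition Q (S : {fset triple}) (x : state) : \bar R :=
  \big[Order.min/+oo%E]_(p <- S | tstate p == x) (tcost p)%:E.

(* Only xs 0, ..., xs K and us 0, ..., us (K - 1) matter. *)
Record FH_admissible (x : state) (S : {fset triple}) (D : ambiguity_set)
    (xs : nat -> state) (us : nat -> input) : Prop := FHAdmissible {
  FH_init : xs 0%N = x;
  FH_dyn : forall k, (k < K)%N -> xs k.+1 = f (xs k) (us k);
  FH_state : forall k, (k < K)%N -> X (xs k);
  FH_input : forall k, (k < K)%N -> U (us k);
  FH_risk : forall k, (k < K)%N -> (worst_risk D (xs k) <= (delta pb)%:E)%E;
  FH_terminal : Pi_state S (xs K)
}.

Definition FH_cost (S : {fset triple}) (xs : nat -> state) (us : nat -> input)
    : \bar R :=
  ((\sum_(k < K) r (xs k) (us k))%:E + Q S (xs K))%E.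

Definition FH_feasible x S D : Prop := exists xs us, FH_admissible x S D xs us.

Definition FH_optimal x S D xs us : Prop :=
  FH_admissible x S D xs us /\
  forall xs' us', FH_admissible x S D xs' us' ->
    (FH_cost S xs us <= FH_cost S xs' us')%E.

Definition FH_attained : Prop :=
  forall (x : state) (S : {fset triple}) (s : seq 'rV[R]_nw),
    sampled_safe_set S -> (forall w, w \in s -> W w) ->
    FH_feasible x S (ambig pb s) ->
    exists xs us, FH_optimal x S (ambig pb s) xs us.

(* The first t passes through the loop of DR_MPC, with any choice of
   optimizers. *)
Definition DR_MPC_steps (S : {fset triple}) (D : ambiguity_set)
    (x : nat -> state) (u : nat -> input) (t : nat) : Prop :=
  x 0%N = xS /\
  forall s, (s < t)%N ->
    [/\ x s <> xF,
        exists xs us, FH_optimal (x s) S D xs us /\ u s = us 0%N &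
        x s.+1 = f (x s) (u s)].

(* Finite trajectories are extended by x_F and the zero input after their
   last time T. *)
Definition rests_from (x : nat -> state) (u : nat -> input) (T : nat) : Prop :=
  forall t, (T <= t)%N -> x t = xF /\ u t = 0.

Definition DR_MPC_returns S D x u T : Prop :=
  DR_MPC_steps S D x u T /\ rests_from x u T.

Definition cost_to_go (x : nat -> state) (u : nat -> input) (t : nat) : R :=
  \big[+%R/0]_(t <= k <oo) r (x k) (u k).

Definition prune (D : ambiguity_set) (S : {fset triple}) : {fset triple} :=
  [fset p in S | ~~ `[< exists q, [/\ q \in S, tindex q = tindex p &
                         ((delta pb)%:E < worst_risk D (tstate q))%E] >]]%fset.

Definition initial_safe_set (S0 : {fset triple}) : Prop :=
  exists (x : nat -> state) (u : nat -> input) (T : nat),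
    [/\ x 0%N = xS,
        forall t, (t < T)%N -> U (u t) /\ x t.+1 = f (x t) (u t),
        rests_from x u T,
        S0 = [fset ((0%N, x t, cost_to_go x u t) : triple) | t in iota 0 T.+1]%fset &
        forall y, Pi_state S0 y ->
          X y /\ forall w, W w -> g y w <= delta pb].

Section Procedure.
(* the initial safe set, the size of the initial dataset, the stream of samples *)
Variables (S0 : {fset triple}) (N0 : nat) (ws : nat -> 'rV[R]_nw).
Variable e : execution R nx nu.

Definition dataset_size (j : nat) : nat :=
  (N0 + \sum_(1 <= i < j.+1) ex_T e i)%N.

Definition dataset (j : nat) : seq 'rV[R]_nw := mkseq ws (dataset_size j).

Definition ambig_at (j : nat) : ambiguity_set := ambig pb (dataset j).

Fixpoint safe_set_at (j : nat) : {fset triple} :=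
  if j is i.+1 then
    prune (ambig_at j)
      (safe_set_at i `|`
       [fset ((j, ex_x e j t, cost_to_go (ex_x e j) (ex_u e j) t) : triple)
         | t in iota 1 (ex_T e j)])%fset
  else S0.

(* Includes the standing assumption 1 <= T_j. *)
Definition iteration_completed (j : nat) : Prop :=
  (1 <= ex_T e j)%N /\
  DR_MPC_returns (safe_set_at j.-1) (ambig_at j.-1)
    (ex_x e j) (ex_u e j) (ex_T e j).

(* The procedure is in iteration j and has done t time-steps of it. *)
Definition reaches (j t : nat) : Prop :=
  (forall i, (1 <= i < j)%N -> iteration_completed i) /\
  DR_MPC_steps (safe_set_at j.-1) (ambig_at j.-1) (ex_x e j) (ex_u e j) t.

End Procedure.
End Problem.

(* Main.v *)
Require Import Defs.
From mathcomp Require Import zify.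

Local Open Scope classical_set_scope.
Local Open Scope ring_scope.

(** Feasibility is the usual recursive-feasibility argument of predictive
    control, made possible by the fact that every sampled-safe-set [S^j]
    consists of whole trajectories: each of its states can be steered by one
    admissible input to one of its states ([forward_closed]).  Pruning
    deletes all triples of an index or none, so it keeps this property
    ([forward_closed_prune]), and it leaves only states that are safe for the
    current ambiguity set [D^j].  A state of [S^j] can therefore be steered
    inside [S^j] for as long as one likes, which makes the finite-horizon
    problem feasible there ([FH_feasible_Pi_state]); and an admissible solution
    of the problem at [x], which ends in [S^j], can be prolonged by one step
    and then shifted, which makes the problem feasible at the next state of the
    closed loop ([FH_feasible_shift]).  The initial state [x_S] stays in every
    [S^j]: the constraint holds along the initial trajectory for all values of
    [w], so its risk is at most [delta] for every distribution ([risk_le_delta])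
    and index 0 is never pruned ([safe_set_at_invariant]).

    For the probabilistic claim, a closed-loop state other than [x_F] is the
    first state of a solution of the finite-horizon problem, so that its risk
    is at most [delta] for all distributions of the ambiguity set; on the event
    that [P] belongs to the ambiguity set this includes [P].  The state [x_F]
    lies on the initial trajectory, so its risk is at most [delta] in any
    case. *)

Section Invariants.
Context {R : realType} {nx nu nw : nat}.
Variable pb : problem R nx nu nw.
Hypothesis hpb : problem_assumptions pb.

Notation state := 'rV[R]_nx.
Notation input := 'rV[R]_nu.
Notation triple := (triple R nx).
Notation ambiguity_set := (set (probability (borel_vec R nw) R)).

(** * Risk of robustly safe states *)

Definition robustly_safe (x : state) : Prop :=
  forall w, Wset pb w -> constr pb x w <= delta pb.

Lemma risk_le_delta mu x : robustly_safe x ->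
  (risk pb mu x <= (delta pb)%:E)%E.
Proof.
move=> safe_x; apply: ereal_inf_lbound => /=.
(* With the level s = delta in the infimum, the positive part vanishes on W. *)
exists (delta pb) => //.
rewrite (eq_integral (cst 0%E)) ?integral0 ?mule0 ?adde0// => w.
by rewrite inE => Ww; rewrite max_r// subr_le0 safe_x.
Qed.

Lemma risk_le_worst_risk (D : ambiguity_set) mu x : D mu ->
  (risk pb mu x <= worst_risk pb D x)%E.
Proof. by move=> Dmu; apply: ereal_sup_ubound; exists mu. Qed.

Lemma worst_risk_le_delta (D : ambiguity_set) x : robustly_safe x ->
  (worst_risk pb D x <= (delta pb)%:E)%E.
Proof.
by move=> safe_x; apply: ge_ereal_sup => _ [mu _ <-]; exact: risk_le_delta.
Qed.

(** * Forward-closed sampled-safe-sets *)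

(** The successor is required to carry the same trajectory index, which is
    what makes the property compatible with pruning by index. *)
Definition forward_closed (S : {fset triple}) : Prop :=
  forall p, p \in S -> exists q u,
    [/\ q \in S, tindex q = tindex p, Uset pb u &
        tstate q = dyn pb (tstate p) u].

Definition states_safe (D : ambiguity_set) (S : {fset triple}) : Prop :=
  forall x, Pi_state S x ->
    Xset pb x /\ (worst_risk pb D x <= (delta pb)%:E)%E.

Lemma prune_sub (D : ambiguity_set) (S : {fset triple}) p :
  p \in prune pb D S -> p \in S.
Proof. by rewrite !inE => /andP[]. Qed.

Lemma forward_closed_prune (D : ambiguity_set) (S : {fset triple}) :
  forward_closed S -> forward_closed (prune pb D S).
Proof.
move=> closed p; rewrite !inE => /andP[Sp /asboolPn keep].
have [q [u [Sq idx Uu eq_q]]] := closed p Sp.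
exists q, u; split=> //; rewrite !inE Sq /=; apply/asboolPn => -[b].
by rewrite idx => bad; apply: keep; exists b.
Qed.

Lemma forward_closedU (S S' : {fset triple}) :
  forward_closed S -> forward_closed S' -> forward_closed (S `|` S')%fset.
Proof.
move=> closed closed' p; rewrite inE => /orP[/closed|/closed'] [q [u []]].
  by move=> Sq *; exists q, u; rewrite inE Sq.
by move=> Sq *; exists q, u; rewrite inE Sq orbT.
Qed.

Lemma prune_worst_risk (D : ambiguity_set) (S : {fset triple}) x :
  Pi_state (prune pb D S) x -> (worst_risk pb D x <= (delta pb)%:E)%E.
Proof.
move=> [p + <-]; rewrite !inE => /andP[Sp /asboolPn keep].
by rewrite leNgt; apply/negP => bad; apply: keep; exists p.
Qed.

(** A trajectory that comes to rest at the equilibrium [x_F] is forward closed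
    from any of its times [m] on, the last triple being its own successor. *)
Lemma forward_closed_trajectory j (x : nat -> state) (u : nat -> input)
    (J : nat -> R) m T :
  x T = x_F pb ->
  (forall t, (t < T)%N -> Uset pb (u t) /\ x t.+1 = dyn pb (x t) (u t)) ->
  forward_closed
    [fset ((j, x t, J t) : triple) | t in iota m (T.+1 - m)]%fset.
Proof.
move=> xT step p /imfsetP[t /=]; rewrite mem_iota => /andP[mt t_range] ->.
have : (t <= T)%N by lia.
rewrite leq_eqVlt => /predU1P[tT|tT].
  exists (j, x t, J t), 0; rewrite tT; split=> //; last 2 first.
  - exact: U0 hpb.
  - by rewrite /tstate/= xT (xF_equilibrium hpb).
  by apply/imfsetP; exists T => //=; rewrite mem_iota; lia.
have [Uu eq_x] := step _ tT.
exists (j, x t.+1, J t.+1), (u t); split=> //.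
by apply/imfsetP; exists t.+1 => //=; rewrite mem_iota; lia.
Qed.

Lemma Pi_state_successor (S : {fset triple}) : forward_closed S ->
  forall x, exists u, Pi_state S x -> Uset pb u /\ Pi_state S (dyn pb x u).
Proof.
move=> closed x; have [Sx|nSx] := pselect (Pi_state S x); last by exists 0.
case: Sx => p Sp <-; have [q [u [Sq _ Uu eq_q]]] := closed p Sp.
by exists u => _; split=> //; exists q.
Qed.

(** * Recursive feasibility *)

Lemma FH_feasible_Pi_state (D : ambiguity_set) (S : {fset triple}) x :
  forward_closed S -> states_safe D S -> Pi_state S x ->
  FH_feasible pb x S D.
Proof.
move=> /Pi_state_successor/choice[k kP] safe Sx.
pose xs n := iter n (fun y => dyn pb y (k y)) x.
have Sxs n : Pi_state S (xs n) by elim: n => //= n /kP[].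
exists xs, (fun n => k (xs n)); split=> // n _; by
  [have [] := safe _ (Sxs n)|have [] := kP _ (Sxs n)].
Qed.

Lemma FH_feasible_shift (D : ambiguity_set) (S : {fset triple}) x xs us :
  forward_closed S -> states_safe D S -> FH_admissible pb x S D xs us ->
  FH_feasible pb (dyn pb x (us 0%N)) S D.
Proof.
move=> /Pi_state_successor closed safe [xs0 xsS xsX usU xsr xsK].
have K0 := horizon_ge1 hpb.
have [v /(_ xsK)[Uv Sv]] := closed (xs (horizon pb)).
have [XK rK] := safe _ xsK.
(* The input v is applied at the terminal state xs K of the old solution,
   which is the state ys (K - 1) of the new one. *)
pose ys n := if (n < horizon pb)%N then xs n.+1
             else dyn pb (xs (horizon pb)) v.
pose vs n := if (n.+1 < horizon pb)%N then us n.+1 else v.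
have last_step n : (n < horizon pb)%N -> (n.+1 < horizon pb)%N = false ->
    n.+1 = horizon pb by lia.
exists ys, vs; split.
- by rewrite /ys K0 xsS// xs0.
- move=> n nK; rewrite /ys /vs nK; case: ifPn => [/xsS//|/negbTE nK'].
  by rewrite (last_step n).
- move=> n nK; rewrite /ys nK.
  by case: (boolP (n.+1 < horizon pb)%N) => [/xsX//|/negbTE/(last_step n nK) ->].
- by move=> n nK; rewrite /vs; case: ifP => // /usU.
- move=> n nK; rewrite /ys nK.
  by case: (boolP (n.+1 < horizon pb)%N) => [/xsr//|/negbTE/(last_step n nK) ->].
- by rewrite /ys ltnn.
Qed.

(** The current state of a running loop is the first state of an admissible
    solution, and the horizon is at least 1, so the stage constraints apply
    to it. *)
Lemma DR_MPC_step_safe (S : {fset triple}) (D : ambiguity_set) x u t s :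
  DR_MPC_steps pb S D x u t -> (s < t)%N ->
  [/\ Xset pb (x s), Uset pb (u s), x s.+1 = dyn pb (x s) (u s) &
      (worst_risk pb D (x s) <= (delta pb)%:E)%E].
Proof.
move=> [_ steps] /steps[_ [xs [us [[adm _] ->]]] ->].
have K0 := horizon_ge1 hpb; rewrite -(FH_init adm).
by split; [exact: FH_state adm _ _|exact: FH_input adm _ _| |
           exact: FH_risk adm _ _].
Qed.

(** * Sampled-safe-sets along the iterations *)

Section SafeSets.
Variables (S0 : {fset triple}) (N0 : nat) (ws : nat -> 'rV[R]_nw).
Variable e : execution R nx nu.
Hypothesis hS0 : initial_safe_set pb S0.

Notation safe_set := (safe_set_at pb S0 N0 ws e).
Notation ambiguity := (ambig_at pb N0 ws e).

Lemma initial_forward_closed : forward_closed S0.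
Proof.
have [x [u [T [_ step rest -> _]]]] := hS0.
rewrite -[T.+1]subn0; apply: forward_closed_trajectory (step).
by have [] := rest T (leqnn T).
Qed.

Lemma initial_index p : p \in S0 -> tindex p = 0%N.
Proof.
by have [x [u [T [_ _ _ -> _]]]] := hS0; case/imfsetP=> t _ ->.
Qed.

Lemma initial_states_safe D : states_safe D S0.
Proof.
have [_ [_ [_ [_ _ _ _ safe]]]] := hS0 => x /safe[Xx safe_x].
by split=> //; exact: worst_risk_le_delta.
Qed.

Lemma initial_Pi_state_xS : Pi_state S0 (x_S pb).
Proof.
have [x [u [T [x0 _ _ -> _]]]] := hS0.
exists (0%N, x 0%N, cost_to_go pb x u 0) => //.
by apply/imfsetP; exists 0%N => //=; rewrite mem_iota.
Qed.

Lemma robustly_safe_xF : robustly_safe (x_F pb).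
Proof.
have [x [u [T [_ _ rest S0E safe]]]] := hS0.
have [xT _] := rest T (leqnn T).
have /safe[]// : Pi_state S0 (x_F pb).
rewrite S0E; exists (0%N, x T, cost_to_go pb x u T) => //.
by apply/imfsetP; exists T => //; change (T \in iota 0 T.+1); rewrite mem_iota leqnn.
Qed.

(** The initial trajectory survives pruning because its states are robustly
    safe and, by the last clause, no triple added later shares its index. *)
Lemma safe_set_at_invariant j :
  (forall i, (1 <= i <= j)%N -> iteration_completed pb S0 N0 ws e i) ->
  [/\ forward_closed (safe_set j), states_safe (ambiguity j) (safe_set j),
      (forall p, p \in S0 -> p \in safe_set j) &
      (forall p, p \in safe_set j -> tindex p = 0%N -> p \in S0)].
Proof.
elim: j => [|j IH] done_.
  by split=> //; [exact: initial_forward_closed|exact: initial_states_safe].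
have [|closed safe S0S S_idx0] := IH.
  by move=> i ij; apply: done_; lia.
have /= [_ [steps rest]] := done_ j.+1 (ltnSn j).
have [xT _] := rest _ (leqnn _).
pose new := [fset ((j.+1, ex_x e j.+1 t,
                    cost_to_go pb (ex_x e j.+1) (ex_u e j.+1) t) : triple)
              | t in iota 1 (ex_T e j.+1)]%fset.
have closed_new : forward_closed new.
  have := @forward_closed_trajectory j.+1 (ex_x e j.+1) (ex_u e j.+1)
    (cost_to_go pb (ex_x e j.+1) (ex_u e j.+1)) 1 (ex_T e j.+1) xT.
  rewrite subSS subn0; apply=> t tT.
  by have [] := DR_MPC_step_safe steps tT.
have new_X p : p \in new -> Xset pb (tstate p).
  case/imfsetP=> t _ ->; rewrite /tstate /=.
  have [tT|Tt] := ltnP t (ex_T e j.+1).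
    by have [] := DR_MPC_step_safe steps tT.
  by have [-> _] := rest t Tt; exact: xF_in hpb.
have new_index p : p \in new -> tindex p = j.+1 by case/imfsetP=> t _ ->.
have idx0 p : p \in (safe_set j `|` new)%fset -> tindex p = 0%N -> p \in S0.
  by rewrite inE => /orP[/S_idx0//|/new_index ->].
rewrite /= -/new; split.
- exact/forward_closed_prune/forward_closedU.
- move=> x Sx; split; last exact: prune_worst_risk Sx.
  case: Sx => p /prune_sub + <-; rewrite inE => /orP[Sp|/new_X//].
  by have [] := safe (tstate p) (ex_intro2 _ _ p Sp erefl).
- move=> p S0p; rewrite !inE (S0S _ S0p) /=; apply/asboolPn => -[q [Sq qp]].
  apply/negP; rewrite -leNgt.
  have S0q : q \in S0 by apply: idx0 => //; rewrite qp (initial_index S0p).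
  by have [] := initial_states_safe (ambiguity j.+1)
                  (ex_intro2 _ _ q S0q erefl).
- by move=> p /prune_sub; exact: idx0.
Qed.

Lemma reaches_feasible j t : (1 <= j)%N -> reaches pb S0 N0 ws e j t ->
  FH_feasible pb (ex_x e j t) (safe_set j.-1) (ambiguity j.-1).
Proof.
case: j => // j _ [done_ [x0 steps]] /=.
have [closed safe S0S _] := safe_set_at_invariant done_.
case: t steps => [_|t /(_ t (ltnSn t))[_ [xs [us [[adm _] uE]]] ->]].
  rewrite x0; apply: FH_feasible_Pi_state => //.
  by case: initial_Pi_state_xS => p /S0S Sp <-; exists p.
by rewrite uE; exact: FH_feasible_shift adm.
Qed.

Lemma iteration_risk P j t : iteration_completed pb S0 N0 ws e j ->
  ambiguity j.-1 P -> (risk pb P (ex_x e j t) <= (delta pb)%:E)%E.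
Proof.
move=> [_ [steps rest]] DP.
have [tT|/rest[-> _]] := ltnP t (ex_T e j); last first.
  exact/risk_le_delta/robustly_safe_xF.
have [_ _ _] := DR_MPC_step_safe steps tT.
exact/le_trans/risk_le_worst_risk.
Qed.

End SafeSets.
End Invariants.

Theorem propositionV1 (R : realType) (nx nu nw : nat)
    (pb : problem R nx nu nw) (hpb : problem_assumptions pb)
    (hatt : FH_attained pb)
    (zeta : R) (hzeta : 0 < zeta < 1)
    (P : probability (borel_vec R nw) R) (hP : P (Wset pb) = 1%E)
    (S0 : {fset triple R nx}) (hS0 : initial_safe_set pb S0)
    (d : measure_display) (Om : measurableType d) (Pr : probability Om R)
    (ws : nat -> {RV Pr >-> borel_vec R nw})
    (hws : iid_samples P ws)
    (hwsW : forall k om, Wset pb (ws k om))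
    (N0 : nat) :
  (forall (om : Om) (e : execution R nx nu) (j t : nat),
     (1 <= j)%N ->
     reaches pb S0 N0 (fun k => ws k om) e j t ->
     FH_feasible pb (ex_x e j t)
       (safe_set_at pb S0 N0 (fun k => ws k om) e j.-1)
       (ambig_at pb N0 (fun k => ws k om) e j.-1))
  /\
  (forall e : Om -> execution R nx nu,
     (forall om j, (1 <= j)%N ->
        iteration_completed pb S0 N0 (fun k => ws k om) (e om) j) ->
     (forall j : nat,
        prob_ge Pr
          [set om | ambig_at pb N0 (fun k => ws k om) (e om) j P] zeta) ->
     forall j t : nat, (1 <= j)%N ->
       prob_ge Pr
         [set om | (risk pb P (ex_x (e om) j t) <= (delta pb)%:E)%E] zeta).
Proof.
split=> [om e j t|e completed reliable j t j1].
  exact: reaches_feasible.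
have [B [mB BD zB]] := reliable j.-1.
exists B; split=> // om /BD DP /=.
by apply: (iteration_risk hpb hS0) DP; exact: completed.
Qed.
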